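(* Let $\mathcal{C}$ be a category. If $\mathcal{C}$ has all finite limits, then the category $\mathsf{P}(\mathcal{C})$ of posetal diagrams labelled in $\mathcal{C}$ has all finite limits.
   Context: Intervals. For a poset $P$, an interval in $P$ is a pair $[a,a']$ with $a,a'\in P$, $a\le a'$. The set $[P]$ of intervals is partially ordered by the relation $\supseteq$, where $[a,a']\supseteq[b,b']$ iff $a\le b$ and $b'\le a'$. Posets are regarded as thin categories, so in $[P]$ there is a unique arrow $[a,a']\to[b,b']$ exactly when $[a,a']\supseteq[b,b']$. A monotone map $f:P\to Q$ induces a monotone map $[f]:[P]\to[Q]$, $[a,a']\mapsto[f(a),f(a')]$. Labelled intervals. $\mathrm{FPos}$ is the category of finite posets and monotone maps. For a category $\mathcal{C}$, the category $\mathsf{L}(\mathcal{C})$ is the Grothendieck construction of the functor $\mathrm{FPos}^{\mathrm{op}}\to\mathrm{Cat}$, $P\mapsto\mathrm{Func}([P],\mathcal{C})$, $f\mapsto -\circ[f]$. Explicitly, objects are pairs $(P,X)$ with $P$ a finite poset and $X:[P]\to\mathcal{C}$ a functor; morphisms $(P,X)\to(Q,Y)$ are pairs $(f,\alpha)$ with $f:P\to Q$ monotone and $\alpha:X\Rightarrow Y\circ[f]$ a natural transformation; composition is $(g,\beta)\circ(f,\alpha)=(g\circ f,\beta_{[f]}\circ\alpha)$. Atomic cospans and local functors. A cospan $a\xrightarrow{f}x\xleftarrow{g}b$ in a category $\mathcal{J}$ is atomic if for every cospan $a\xrightarrow{f'}y\xleftarrow{g'}b$ and every map $h:y\to x$ with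 $h\circ f'=f$ and $h\circ g'=g$, the map $h$ is an isomorphism. A functor $X:\mathcal{J}\to\mathcal{C}$ is local if it preserves all pullbacks of atomic cospans (those that exist in $\mathcal{J}$). Posetal diagrams. A finite distributive lattice is a finite poset with all finite meets and joins (including $\top$ and $\bot$) in which $\wedge$ and $\vee$ distribute over each other; a lattice homomorphism is a map preserving all finite meets and joins (including $\top,\bot$). $\mathsf{P}(\mathcal{C})$ is the subcategory of $\mathsf{L}(\mathcal{C})$ whose objects are the pairs $(P,X)$ with $P$ a finite distributive lattice and $X$ a local functor, and whose morphisms are the pairs $(f,\alpha)$ with $f$ a lattice homomorphism. *)

(* Defs.v *)
From HB Require Import structures.
From mathcomp Require Import all_boot all_order.
From mathcomp Require Import boolp.

Set Implicit Arguments.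
Unset Strict Implicit.
Unset Printing Implicit Defensive.

Import Order.TTheory.
Local Open Scope order_scope.

Declare Scope cat_scope.
Delimit Scope cat_scope with C.
Local Open Scope cat_scope.

(* Equality of morphisms is Leibniz equality. *)
Record category := Category {
  ob :> Type;
  hom : ob -> ob -> Type;
  idc : forall a, hom a a;
  comp : forall a b c, hom b c -> hom a b -> hom a c;
  comp1c : forall a b (f : hom a b), comp (idc b) f = f;
  compc1 : forall a b (f : hom a b), comp f (idc a) = f;
  compA : forall a b c d (h : hom c d) (g : hom b c) (f : hom a b),
    comp h (comp g f) = comp (comp h g) f
}.
Arguments hom {c} a b : rename.
Arguments idc {c} a : rename.
Arguments comp {c a b c0} g f : rename.
Notation "g '∘' f" := (comp g f)
  (at level 40, left associativity) : cat_scope.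

Record functor (C D : category) := Functor {
  fob :> C -> D;
  fmap : forall a b, hom a b -> hom (fob a) (fob b);
  fmap1 : forall a, fmap (idc a) = idc (fob a);
  fmapM : forall a b c (g : hom b c) (f : hom a b),
    fmap (g ∘ f) = fmap g ∘ fmap f
}.
Arguments fmap {C D} F {a b} f : rename.

Lemma functor_comp_id (C D E : category) (G : functor D E) (F : functor C D) a :
  fmap G (fmap F (idc a)) = idc (G (F a)).
Proof. by rewrite !fmap1. Qed.

Lemma functor_comp_comp (C D E : category) (G : functor D E) (F : functor C D)
  a b c (g : hom b c) (f : hom a b) :
  fmap G (fmap F (g ∘ f)) = fmap G (fmap F g) ∘ fmap G (fmap F f).
Proof. by rewrite !fmapM. Qed.

Definition functor_comp (C D E : category) (G : functor D E) (F : functor C D) :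
    functor C E :=
  Functor (functor_comp_id G F) (functor_comp_comp G F).

Record nattrans (C D : category) (F G : functor C D) := NatTrans {
  ntapp :> forall a, hom (F a) (G a);
  ntnat : forall a b (f : hom a b), ntapp b ∘ fmap F f = fmap G f ∘ ntapp a
}.

Lemma nattrans_eq (C D : category) (F G : functor C D) (s t : nattrans F G) :
  (forall a, s a = t a) -> s = t.
Proof.
case: s t => [s sP] [t tP] /= st.
have {}st := functional_extensionality_dep st; subst t.
by congr NatTrans; apply: Prop_irrelevance.
Qed.

Definition is_iso (C : category) (a b : C) (f : hom a b) : Prop :=
  exists g : hom b a, g ∘ f = idc a /\ f ∘ g = idc b.

Definition is_cone (J C : category) (D : functor J C) (w : C)
    (q : forall j, hom w (D j)) : Prop :=
  forall i j (u : hom i j), fmap D u ∘ q i = q j.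

Definition is_limit (J C : category) (D : functor J C) (l : C)
    (p : forall j, hom l (D j)) : Prop :=
  is_cone p /\
  forall (w : C) (q : forall j, hom w (D j)), is_cone q ->
    exists! m : hom w l, forall j, p j ∘ m = q j.

(* The [finite_set] of the classical library would bound the universe of its
   argument by that of eqType carriers, which is too small for the type of
   objects of a category of labelled posets. *)
Definition finite_type (T : Type) : Prop :=
  exists (n : nat) (e : 'I_n -> T), forall x : T, exists i : 'I_n, e i = x.

Definition finite_category (J : category) : Prop :=
  finite_type J /\ forall a b : J, finite_type (hom a b).

Definition has_finite_limits (C : category) : Prop :=
  forall J : category, finite_category J ->
  forall D : functor J C,
  exists (l : C) (p : forall j, hom l (D j)), is_limit p.

Definition is_pullback (C : category) (a b x w : C) (f : hom a x) (g : hom b x)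
    (p : hom w a) (q : hom w b) : Prop :=
  f ∘ p = g ∘ q /\
  forall (v : C) (p' : hom v a) (q' : hom v b), f ∘ p' = g ∘ q' ->
    exists! m : hom v w, p ∘ m = p' /\ q ∘ m = q'.

Definition atomic_cospan (J : category) (a b x : J)
    (f : hom a x) (g : hom b x) : Prop :=
  forall (y : J) (f' : hom a y) (g' : hom b y) (h : hom y x),
    h ∘ f' = f -> h ∘ g' = g -> is_iso h.

Definition local_functor (J C : category) (X : functor J C) : Prop :=
  forall (a b x : J) (f : hom a x) (g : hom b x), atomic_cospan f g ->
  forall (w : J) (p : hom w a) (q : hom w b), is_pullback f g p q ->
    is_pullback (fmap X f) (fmap X g) (fmap X p) (fmap X q).

Section Thin.
Context {d : Order.disp_t} (T : porderType d).

Definition thin_comp (a b c : T) (g : b <= c) (f : a <= b) : a <= c :=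
  le_trans f g.

Definition thin : category := @Category T (fun a b => a <= b) (@lexx d T)
  thin_comp (fun _ _ _ => bool_irrelevance _ _)
  (fun _ _ _ => bool_irrelevance _ _)
  (fun _ _ _ _ _ _ _ => bool_irrelevance _ _).

End Thin.

Definition thin_functor {d d' : Order.disp_t} (T : porderType d)
    (T' : porderType d') (f : T -> T') (f_mono : {homo f : x y / x <= y}) :
    functor (thin T) (thin T') :=
  @Functor (thin T) (thin T') f f_mono
    (fun _ => bool_irrelevance _ _) (fun _ _ _ _ _ => bool_irrelevance _ _).

(* Primitive projections make [pinterval_map] strictly functorial, that is, up
   to conversion. *)
Set Primitive Projections.
Record pinterval {d : Order.disp_t} (P : porderType d) := PInterval {
  lower : P;
  upper : P;
  lower_le_upper : lower <= upper
}.
Unset Primitive Projections.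

Section IntervalPoset.
Context {d : Order.disp_t} {P : porderType d}.
Implicit Types i j k : pinterval P.

Definition pinterval_pair i : P * P := (lower i, upper i).

Definition pinterval_of_pair (u : P * P) : option (pinterval P) :=
  if @idP (u.1 <= u.2) is ReflectT h then Some (PInterval h) else None.

Lemma pinterval_pairK : pcancel pinterval_pair pinterval_of_pair.
Proof.
move=> [a b ab]; rewrite /pinterval_of_pair /pinterval_pair /=.
by case: {-}_ / idP => // h; rewrite (bool_irrelevance h ab).
Qed.

HB.instance Definition _ := Choice.copy (pinterval P) (pcan_type pinterval_pairK).

Definition pinterval_supset i j : bool :=
  (lower i <= lower j) && (upper j <= upper i).

Lemma pinterval_supset_refl : reflexive pinterval_supset.
Proof. by move=> i; rewrite /pinterval_supset !lexx. Qed.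

Lemma pinterval_supset_anti : antisymmetric pinterval_supset.
Proof.
move=> [a a' aa'] [b b' bb']; rewrite /pinterval_supset /=.
move=> /andP[/andP[ab b'a'] /andP[ba a'b']].
have eab : a = b by apply/le_anti; rewrite ab ba.
have eab' : a' = b' by apply/le_anti; rewrite a'b' b'a'.
by subst b b'; rewrite (bool_irrelevance aa' bb').
Qed.

Lemma pinterval_supset_trans : transitive pinterval_supset.
Proof.
move=> j i k /andP[ij ji] /andP[jk kj].
by rewrite /pinterval_supset (le_trans ij jk) (le_trans kj ji).
Qed.

(* Intervals are ordered by reverse inclusion: [i <= j] means that [i] contains
   [j]. *)
HB.instance Definition _ := Order.Le_isPOrder.Build d (pinterval P)
  pinterval_supset_refl pinterval_supset_anti pinterval_supset_trans.

Lemma le_pintervalE i j :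
  (i <= j) = (lower i <= lower j) && (upper j <= upper i).
Proof. by []. Qed.

End IntervalPoset.

Definition intervals {d : Order.disp_t} (P : porderType d) : category :=
  thin (pinterval P).

Section IntervalMap.
Context {d d' : Order.disp_t} {P : porderType d} {Q : porderType d'}.
Variables (f : P -> Q) (f_mono : {homo f : x y / x <= y}).

Definition pinterval_map (i : pinterval P) : pinterval Q :=
  PInterval (f_mono (lower_le_upper i)).

Lemma pinterval_map_mono : {homo pinterval_map : i j / i <= j}.
Proof.
by move=> i j; rewrite !le_pintervalE => /andP[? ?]; rewrite !f_mono.
Qed.

Definition interval_functor : functor (intervals P) (intervals Q) :=
  thin_functor pinterval_map_mono.

End IntervalMap.

Section LabelledIntervals.
Variable C : category.

(* The display is only a notational tag and carries no information. *)
Record labelled_poset := LabelledPoset {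
  lposet_disp : Order.disp_t;
  lposet : finPOrderType lposet_disp;
  lposet_label : functor (intervals lposet) C
}.

Record lhom (A B : labelled_poset) := LHom {
  lhom_map : lposet A -> lposet B;
  lhom_mono : {homo lhom_map : x y / x <= y};
  lhom_nat : nattrans (lposet_label A)
    (functor_comp (lposet_label B) (interval_functor lhom_mono))
}.

(* The statements below on identities and composites typecheck because
   intervals satisfy definitional eta. *)
Definition id_mono d (P : porderType d) : {homo @id P : x y / x <= y} :=
  fun _ _ h => h.

Definition comp_mono d (P : porderType d) d' (Q : porderType d')
    d'' (S : porderType d'') (g : Q -> S) (f : P -> Q)
    (g_mono : {homo g : x y / x <= y}) (f_mono : {homo f : x y / x <= y}) :
    {homo (fun x => g (f x)) : x y / x <= y} :=
  fun _ _ h => g_mono _ _ (f_mono _ _ h).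

Lemma lhom_id_natural (A : labelled_poset) (X := lposet_label A)
    (i j : intervals (lposet A)) (u : hom i j) :
  idc (X j) ∘ fmap X u =
  fmap (functor_comp X (interval_functor (@id_mono _ (lposet A)))) u
    ∘ idc (X i).
Proof. by rewrite comp1c compc1; congr fmap; apply: bool_irrelevance. Qed.

Definition lhom_id (A : labelled_poset) : lhom A A :=
  @LHom A A id (@id_mono _ (lposet A))
    (@NatTrans _ _ (lposet_label A) (functor_comp (lposet_label A)
        (interval_functor (@id_mono _ (lposet A))))
      (fun i => idc (lposet_label A i)) (@lhom_id_natural A)).

Section Comp.
Variables (A B D : labelled_poset) (g : lhom B D) (f : lhom A B).

Definition lhom_comp_app (i : intervals (lposet A)) :
    hom (lposet_label A i)
        (functor_comp (lposet_label D)
          (interval_functor (comp_mono (@lhom_mono _ _ g) (@lhom_mono _ _ f))) i) :=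
  lhom_nat g (interval_functor (@lhom_mono _ _ f) i) ∘ lhom_nat f i.

Lemma lhom_comp_natural (i j : intervals (lposet A)) (u : hom i j) :
  lhom_comp_app j ∘ fmap (lposet_label A) u =
  fmap (functor_comp (lposet_label D)
    (interval_functor (comp_mono (@lhom_mono _ _ g) (@lhom_mono _ _ f)))) u
    ∘ lhom_comp_app i.
Proof.
rewrite /lhom_comp_app -compA (ntnat (lhom_nat f) u) !compA; congr (_ ∘ _).
etransitivity.
  exact: ntnat (lhom_nat g) _ _ (fmap (interval_functor (@lhom_mono _ _ f)) u).
congr (_ ∘ _).
by apply: (f_equal (@fmap _ _ (lposet_label D) _ _)); apply: bool_irrelevance.
Qed.

Definition lhom_comp : lhom A D := LHom (NatTrans lhom_comp_natural).

End Comp.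

Lemma lhom_comp1c (A B : labelled_poset) (f : lhom A B) :
  lhom_comp (lhom_id B) f = f.
Proof.
case: f => f f_mono al; apply: (f_equal (@LHom A B f f_mono)).
by apply: nattrans_eq => i; apply: comp1c.
Qed.

Lemma lhom_compc1 (A B : labelled_poset) (f : lhom A B) :
  lhom_comp f (lhom_id A) = f.
Proof.
case: f => f f_mono al; apply: (f_equal (@LHom A B f f_mono)).
by apply: nattrans_eq => i; apply: compc1.
Qed.

Lemma lhom_compA (A B D E : labelled_poset)
    (h : lhom D E) (g : lhom B D) (f : lhom A B) :
  lhom_comp h (lhom_comp g f) = lhom_comp (lhom_comp h g) f.
Proof.
apply: (f_equal (@LHom A E _ (comp_mono (@lhom_mono _ _ h)
  (comp_mono (@lhom_mono _ _ g) (@lhom_mono _ _ f))))).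
by apply: nattrans_eq => i; apply: compA.
Qed.

Definition labelled_intervals : category :=
  Category lhom_comp1c lhom_compc1 lhom_compA.

End LabelledIntervals.

(* The subcategory of [D] with objects the [u a] and morphisms those in [S]. *)
Section Subcategory.
Variables (D : category) (O : Type) (u : O -> D).
Variable S : forall a b : O, hom (u a) (u b) -> Prop.
Hypothesis S1 : forall a, S (idc (u a)).
Hypothesis SM : forall a b c (g : hom (u b) (u c)) (f : hom (u a) (u b)),
  S g -> S f -> S (g ∘ f).

Definition sub_hom (a b : O) : Type := {f : hom (u a) (u b) | S f}.

Lemma sub_hom_eq (a b : O) (f g : sub_hom a b) : sval f = sval g -> f = g.
Proof.
case: f g => [f Sf] [g Sg] /= fg; subst g.
by congr exist; apply: Prop_irrelevance.
Qed.

Definition sub_id (a : O) : sub_hom a a := exist _ _ (S1 a).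

Definition sub_comp (a b c : O) (g : sub_hom b c) (f : sub_hom a b) :
    sub_hom a c :=
  exist _ _ (SM (proj2_sig g) (proj2_sig f)).

Lemma sub_comp1c a b (f : sub_hom a b) : sub_comp (sub_id b) f = f.
Proof. by apply: sub_hom_eq; apply: comp1c. Qed.

Lemma sub_compc1 a b (f : sub_hom a b) : sub_comp f (sub_id a) = f.
Proof. by apply: sub_hom_eq; apply: compc1. Qed.

Lemma sub_compA a b c d (h : sub_hom c d) (g : sub_hom b c) (f : sub_hom a b) :
  sub_comp h (sub_comp g f) = sub_comp (sub_comp h g) f.
Proof. by apply: sub_hom_eq; apply: compA. Qed.

Definition subcategory : category := Category sub_comp1c sub_compc1 sub_compA.

End Subcategory.

Section PosetalDiagrams.
Variable C : category.

(* [finTBDistrLatticeType] allows the one-element lattice, where \bot = \top.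
   The lattice operations being determined by the order, objects of P(C) are
   objects of L(C) with a property. *)
Record posetal_diagram := PosetalDiagram {
  pdiag_disp : Order.disp_t;
  pdiag_lattice : finTBDistrLatticeType pdiag_disp;
  pdiag_label : functor (intervals pdiag_lattice) C;
  pdiag_local : local_functor pdiag_label
}.

Definition pdiag_labelled (A : posetal_diagram) : labelled_intervals C :=
  @LabelledPoset C (pdiag_disp A) (pdiag_lattice A) (pdiag_label A).

Definition lattice_hom d (P : finTBDistrLatticeType d)
    d' (Q : finTBDistrLatticeType d') (f : P -> Q) : Prop :=
  [/\ Order.meet_morphism f, Order.join_morphism f,
      f \bot = \bot & f \top = \top].

Definition posetal_hom (A B : posetal_diagram)
    (f : hom (pdiag_labelled A) (pdiag_labelled B)) : Prop :=
  @lattice_hom _ (pdiag_lattice A) _ (pdiag_lattice B) (lhom_map f).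

Lemma posetal_hom1 (A : posetal_diagram) :
  @posetal_hom A A (idc (pdiag_labelled A)).
Proof. by split. Qed.

Lemma posetal_homM (A B D : posetal_diagram)
    (g : hom (pdiag_labelled B) (pdiag_labelled D))
    (f : hom (pdiag_labelled A) (pdiag_labelled B)) :
  posetal_hom g -> posetal_hom f -> @posetal_hom A D (g ∘ f).
Proof.
move=> [gI gU g0 g1] [fI fU f0 f1]; split => /=.
- by move=> x y; rewrite /= fI gI.
- by move=> x y; rewrite /= fU gU.
- by rewrite f0 g0.
- by rewrite f1 g1.
Qed.

Definition posetal_diagrams : category := subcategory posetal_hom1 posetal_homM.

End PosetalDiagrams.

(* Main.v *)
(* The limit of a finite diagram of posetal diagrams (P_i, X_i) has as lattice the
   compatible families in the product of the P_i, and labels an interval I by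
   the limit of the X_i(I_i), where I_i is the i-th projection of I. In the
   poset of intervals a cospan is atomic exactly when its apex is the whole
   intersection of its feet, and a pullback is the interval hull of the feet;
   both are expressed by meets and joins of end points, so the projections, being
   lattice homomorphisms, preserve them. Locality of the limit labelling then
   follows because limits commute with pullbacks. *)
From HB Require Import structures.
From mathcomp Require Import all_boot all_order.
From mathcomp Require Import boolp.
Require Import Defs.

Set Implicit Arguments.
Unset Strict Implicit.
Unset Printing Implicit Defensive.

Import Order.TTheory.
Local Open Scope order_scope.
Local Open Scope cat_scope.

(** * Finite distributive lattice of compatible families *)

Section CompatibleFamilies.
Variables (T : finType) (d : T -> Order.disp_t).
Variable L : forall i, finTBDistrLatticeType (d i).
Variable K : forall i j, (L i -> L j) -> Prop.

(** Only the index type [T] is finite. The maps form a mere relation [K], and compatibility is made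
    decidable classically by [asbool]. *)
Definition compatible (x : forall i, L i) : Prop :=
  forall i j (f : L i -> L j), K f -> f (x i) = x j.

(* The closure hypothesis is an argument of the type so that the lattice
   structure, which depends on it, can be canonical. *)
Definition compatible_family
    of (forall i j (f : L i -> L j), K f -> lattice_hom f) : Type :=
  {x : {dffun forall i, L i} | `[< compatible x >]}.

Hypothesis K_hom : forall i j (f : L i -> L j), K f -> lattice_hom f.

Local Notation P := (compatible_family K_hom).

HB.instance Definition _ := Finite.copy P
  {x : {dffun forall i, L i} | `[< compatible x >]}.

Definition family_proj (i : T) (x : P) : L i := sval x i.

Definition mk_family (x : forall i, L i) (xP : compatible x) : P.
Proof.
exists [ffun i => x i]; apply/asboolP => i j f Kf.
by rewrite !ffunE; apply: xP.
Defined.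

Lemma family_projE x xP i : family_proj i (@mk_family x xP) = x i.
Proof. exact: ffunE. Qed.

Lemma family_compatible (x : P) : compatible (family_proj^~ x).
Proof. exact: asboolW (proj2_sig x). Qed.

Lemma family_eq (x y : P) : (forall i, family_proj i x = family_proj i y) -> x = y.
Proof. by move=> xy; apply/val_inj/ffunP => i; apply: xy. Qed.

Lemma compatible_meet (x y : P) :
  compatible (fun i => family_proj i x `&` family_proj i y).
Proof.
move=> i j f Kf; have [fI _ _ _] := K_hom Kf.
by rewrite fI !(family_compatible _ Kf).
Qed.

Lemma compatible_join (x y : P) :
  compatible (fun i => family_proj i x `|` family_proj i y).
Proof.
move=> i j f Kf; have [_ fU _ _] := K_hom Kf.
by rewrite fU !(family_compatible _ Kf).
Qed.

Lemma compatible_bot : compatible (fun _ => \bot).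
Proof. by move=> i j f /K_hom[]. Qed.

Lemma compatible_top : compatible (fun _ => \top).
Proof. by move=> i j f /K_hom[]. Qed.

Definition family_le (x y : P) : bool :=
  [forall i, family_proj i x <= family_proj i y].
Definition family_meet (x y : P) : P := mk_family (compatible_meet x y).
Definition family_join (x y : P) : P := mk_family (compatible_join x y).

Lemma family_le_def x y : family_le x y = (family_meet x y == x).
Proof.
apply/forallP/eqP => [xy | <- i]; last by rewrite family_projE leIr.
by apply: family_eq => i; rewrite family_projE; apply/meet_idPl/xy.
Qed.

Lemma family_meetC : commutative family_meet.
Proof. by move=> x y; apply: family_eq => i; rewrite !family_projE meetC. Qed.
Lemma family_joinC : commutative family_join.
Proof. by move=> x y; apply: family_eq => i; rewrite !family_projE joinC. Qed.
Lemma family_meetA : associative family_meet.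
Proof. by move=> x y z; apply: family_eq => i; rewrite !family_projE meetA. Qed.
Lemma family_joinA : associative family_join.
Proof. by move=> x y z; apply: family_eq => i; rewrite !family_projE joinA. Qed.
Lemma family_joinKI y x : family_meet x (family_join x y) = x.
Proof. by apply: family_eq => i; rewrite !family_projE joinKI. Qed.
Lemma family_meetKU y x : family_join x (family_meet x y) = x.
Proof. by apply: family_eq => i; rewrite !family_projE meetKU. Qed.
Lemma family_meetUl : left_distributive family_meet family_join.
Proof. by move=> x y z; apply: family_eq => i; rewrite !family_projE meetUl. Qed.
Lemma family_meetxx : idempotent_op family_meet.
Proof. by move=> x; apply: family_eq => i; rewrite !family_projE meetxx. Qed.

HB.instance Definition _ := Order.isMeetJoinDistrLattice.Build
  (Order.Disp tt tt) P family_le_def (fun _ _ => erefl) family_meetC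
  family_joinC family_meetA family_joinA family_joinKI family_meetKU
  family_meetUl family_meetxx.

Lemma family_bot_le (x : P) : mk_family compatible_bot <= x.
Proof. by apply/forallP => i; rewrite family_projE le0x. Qed.
Lemma family_le_top (x : P) : x <= mk_family compatible_top.
Proof. by apply/forallP => i; rewrite family_projE lex1. Qed.

HB.instance Definition _ := Order.hasBottom.Build _ P family_bot_le.
HB.instance Definition _ := Order.hasTop.Build _ P family_le_top.

Lemma le_familyP (x y : P) :
  reflect (forall i, family_proj i x <= family_proj i y) (x <= y).
Proof. exact: forallP. Qed.

(** All operations are pointwise. This makes the projections usable as legs of a cone in P(C), and
    lets them carry lattice formulas for intervals to each factor. *)
Lemma family_proj_hom i : lattice_hom (family_proj i : P -> L i).
Proof.
split=> [x y|x y||].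
- exact: family_projE (compatible_meet x y) i.
- exact: family_projE (compatible_join x y) i.
- exact: family_projE compatible_bot i.
- exact: family_projE compatible_top i.
Qed.

Definition compatible_lattice : finTBDistrLatticeType (Order.Disp tt tt) := P.

End CompatibleFamilies.

(** * Replacing the shape by a full image over an enumeration *)

(* The objects of a finite category are only enumerated by some ['I_n], so
   families over them form no [finType]; families over the enumeration do. *)
Section FullImage.
Variables (T : Type) (J : category) (e : T -> J).

Definition full_image : category :=
  @Category T (fun i j => hom (e i) (e j)) (fun i => idc (e i))
    (fun i j k g f => g ∘ f) (fun i j f => comp1c f) (fun i j f => compc1 f)
    (fun i j k l h g f => compA h g f).

Definition full_image_restrict (C : category) (D : functor J C) :
    functor full_image C :=
  @Functor full_image C (fun i => D (e i)) (fun i j u => fmap D u)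
    (fun i => fmap1 D (e i)) (fun i j k g f => fmapM D g f).

(** Surjectivity of [e] makes the full image equivalent to [J], repeated indices being isomorphic;
    the leg at [j] is transported from a chosen preimage. *)
Lemma limit_of_full_image (C : category) (D : functor J C) (l : C)
    (p : forall i, hom l (full_image_restrict D i)) :
    (forall j, exists i, e i = j) -> is_limit p ->
  exists p' : forall j, hom l (D j), is_limit p'.
Proof.
move=> e_surj [p_cone p_univ].
(* Recording [e i = j] as a pair of inverse arrows avoids casts between hom types. *)
have iso j : {i : T & {c : hom (e i) j & {c' : hom j (e i) |
    c ∘ c' = idc j /\ c' ∘ c = idc (e i)}}}.
  have [i <-] := cid (e_surj j); exists i, (idc _), (idc _).
  by rewrite comp1c.
pose s j := projT1 (iso j).
pose c j : hom (e (s j)) j := projT1 (projT2 (iso j)).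
pose c' j : hom j (e (s j)) := sval (projT2 (projT2 (iso j))).
have cK j : c j ∘ c' j = idc j by case: (proj2_sig (projT2 (projT2 (iso j)))).
exists (fun j => fmap D (c j) ∘ p (s j)); split.
  (* Conjugating [u] by the chosen isomorphisms gives an arrow between preimages, because the image
     is full. *)
  move=> i j u; have <- := p_cone (s i) (s j) (c' j ∘ (u ∘ c i)).
  by rewrite /= !compA -!fmapM !compA cK comp1c.
move=> w q q_cone.
have [|m [m_eq m_uniq]] := p_univ w (fun i => q (e i)).
  by move=> i j u; apply: q_cone.
exists m; split=> [j | m' m'_eq].
  by rewrite -compA m_eq; apply: q_cone.
apply: m_uniq => i; rewrite -m'_eq.
(* The preimage [s (e i)] may differ from [i], but [c (e i)] is an arrow between them in the full
   image, so the cone equation relates their legs. *)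
have <- := p_cone (s (e i)) i (c (e i)).
by [].
Qed.

End FullImage.

Lemma full_image_finite n (J : category) (e : 'I_n -> J) :
  finite_category J -> finite_category (full_image e).
Proof.
move=> [_ Jhom]; split=> [|i j]; last exact: Jhom.
by exists n, id => i; exists i.
Qed.

(** * Limits commute with pullbacks *)

Lemma limit_joint_monic (J C : category) (F : functor J C) (l : C)
    (p : forall j, hom l (F j)) (v : C) (m m' : hom v l) :
  is_limit p -> (forall j, p j ∘ m = p j ∘ m') -> m = m'.
Proof.
move=> [p_cone p_univ] mm'.
have [|m0 [_ m0_uniq]] := p_univ v (fun j => p j ∘ m').
  by move=> i j u; rewrite compA p_cone.
by rewrite -(m0_uniq m) // (m0_uniq m').
Qed.

(** A competing square is projected to each stage [j] and factored through the pullback there.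
    Uniqueness at each stage makes these factorizations a cone over [Fw], which then factors through
    [w]. *)
Lemma limit_pullback (J C : category) (Fa Fb Fx Fw : functor J C)
    (f : nattrans Fa Fx) (g : nattrans Fb Fx)
    (p : nattrans Fw Fa) (q : nattrans Fw Fb)
    (a b x w : C) (pa : forall j, hom a (Fa j)) (pb : forall j, hom b (Fb j))
    (px : forall j, hom x (Fx j)) (pw : forall j, hom w (Fw j))
    (f' : hom a x) (g' : hom b x) (p' : hom w a) (q' : hom w b) :
    is_limit pa -> is_limit pb -> is_limit px -> is_limit pw ->
    (forall j, px j ∘ f' = f j ∘ pa j) -> (forall j, px j ∘ g' = g j ∘ pb j) ->
    (forall j, pa j ∘ p' = p j ∘ pw j) -> (forall j, pb j ∘ q' = q j ∘ pw j) ->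
    (forall j, is_pullback (f j) (g j) (p j) (q j)) ->
  is_pullback f' g' p' q'.
Proof.
move=> pa_lim pb_lim px_lim pw_lim f'E g'E p'E q'E pb_j.
split.
  apply: (limit_joint_monic px_lim) => // j.
  rewrite !compA f'E g'E -!compA p'E q'E !compA.
  by case: (pb_j j) => ->.
move=> v r s rs.
have rs_j j : f j ∘ (pa j ∘ r) = g j ∘ (pb j ∘ s).
  by rewrite !compA -f'E -g'E -!compA rs.
pose t j := cid (proj2 (pb_j j) _ _ _ (rs_j j)).
have t_cone : is_cone (D := Fw) (fun j => sval (t j)).
  move=> i j u.
  have [_ t_uniq] := proj2_sig (t j).
  (* By naturality of [p] and [q], [fmap Fw u ∘ sval (t i)] solves the same factorization problem at
     stage [j] as [t j]. *)
  symmetry; apply: t_uniq; rewrite !compA.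
  have [[ti1 ti2] _] := proj2_sig (t i).
  by rewrite !ntnat -!compA ti1 ti2 !compA (proj1 pa_lim) (proj1 pb_lim).
have [m [mE m_uniq]] := proj2 pw_lim _ _ t_cone.
exists m; split.
  split.
    apply: (limit_joint_monic pa_lim) => // j.
    by rewrite compA p'E -compA mE; case: (proj2_sig (t j)) => -[].
  apply: (limit_joint_monic pb_lim) => // j.
  by rewrite compA q'E -compA mE; case: (proj2_sig (t j)) => -[].
move=> m' [p'm' q'm']; apply: m_uniq => j.
have [_ t_uniq] := proj2_sig (t j).
by symmetry; apply: t_uniq; rewrite !compA -p'E -q'E -!compA p'm' q'm'.
Qed.

(** * Atomic cospans and pullbacks of intervals *)

Section IntervalPullbacks.
Context {d : Order.disp_t} {L : finTBDistrLatticeType d}.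
Implicit Types a b x w : intervals L.

(** The intersection of the feet contains [x], so it is an interval and the cospan factors through
    it; atomicity then forces it to be [x]. Conversely, any factoring [y] lies inside both feet,
    hence inside [x]. *)
Lemma atomic_cospanP a b x (f : hom a x) (g : hom b x) :
  atomic_cospan f g <->
  lower x = lower a `|` lower b /\ upper x = upper a `&` upper b.
Proof.
have /andP[ax xa] : a <= x := f; have /andP[bx xb] : b <= x := g.
split=> [atomic | [lx ux] y f' g' h _ _].
  have cap_le : lower a `|` lower b <= upper a `&` upper b.
    apply: (@le_trans _ _ (lower x)); first by rewrite leUx ax.
    by apply: (le_trans (lower_le_upper x)); rewrite lexI xa.
  have ac : a <= PInterval cap_le by rewrite le_pintervalE leUl leIl.
  have bc : b <= PInterval cap_le by rewrite le_pintervalE leUr leIr.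
  have cx : PInterval cap_le <= x.
    by rewrite le_pintervalE leUx lexI ax bx xa xb.
  have [k _] := atomic _ ac bc cx (bool_irrelevance _ _) (bool_irrelevance _ _).
  have -> : x = PInterval cap_le by apply/le_anti; rewrite k cx.
  by [].
have /andP[ay ya] : a <= y := f'; have /andP[b_y yb] : b <= y := g'.
have xy : x <= y by rewrite le_pintervalE lx ux leUx lexI ay b_y ya yb.
by exists xy; split; apply: bool_irrelevance.
Qed.

(** In a thin category every square commutes, so a pullback is the greatest lower bound of the feet,
    whatever the apex. Under reverse inclusion this is the smallest interval containing both. *)
Lemma interval_pullbackP a b x w (f : hom a x) (g : hom b x)
    (p : hom w a) (q : hom w b) :
  is_pullback f g p q <->
  lower w = lower a `&` lower b /\ upper w = upper a `|` upper b.
Proof.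
have /andP[wa aw] : w <= a := p; have /andP[wb bw] : w <= b := q.
split=> [[_ univ] | [lw uw]].
  have hull_le : lower a `&` lower b <= upper a `|` upper b.
    exact: (le_trans (leIl _ _) (le_trans (lower_le_upper a) (leUl _ _))).
  have ha : PInterval hull_le <= a by rewrite le_pintervalE leIl leUl.
  have hb : PInterval hull_le <= b by rewrite le_pintervalE leIr leUr.
  have [hw _] := univ _ ha hb (bool_irrelevance _ _).
  have wh : w <= PInterval hull_le.
    by rewrite le_pintervalE lexI leUx wa wb aw bw.
  have -> : w = PInterval hull_le by apply/le_anti; rewrite wh hw.
  by [].
split=> [|v p' q' _]; first exact: bool_irrelevance.
have /andP[va av] : v <= a := p'; have /andP[vb bv] : v <= b := q'.
have vw : v <= w by rewrite le_pintervalE lw uw leUx lexI va vb av bv.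
exists vw; split=> [|m _]; last exact: bool_irrelevance.
by split; apply: bool_irrelevance.
Qed.

End IntervalPullbacks.

Section LatticeHomPreserves.
Context {d d' : Order.disp_t} {L : finTBDistrLatticeType d}
  {M : finTBDistrLatticeType d'} (h : L -> M).
Hypotheses (h_hom : lattice_hom h) (h_mono : {homo h : x y / x <= y}).
Variables (a b x w : intervals L) (f : hom a x) (g : hom b x)
  (p : hom w a) (q : hom w b).

Lemma interval_functor_atomic : atomic_cospan f g ->
  atomic_cospan (fmap (interval_functor h_mono) f)
                (fmap (interval_functor h_mono) g).
Proof.
have [hI hU _ _] := h_hom.
by move=> /atomic_cospanP[lx ux]; apply/atomic_cospanP; rewrite /= lx ux hI hU.
Qed.

Lemma interval_functor_pullback : is_pullback f g p q ->
  is_pullback (fmap (interval_functor h_mono) f)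
    (fmap (interval_functor h_mono) g) (fmap (interval_functor h_mono) p)
    (fmap (interval_functor h_mono) q).
Proof.
have [hI hU _ _] := h_hom.
by move=> /interval_pullbackP[lw uw]; apply/interval_pullbackP;
   rewrite /= lw uw hI hU.
Qed.

End LatticeHomPreserves.

(** * Comparing label components without casts *)

Section Along.
Variable C : category.
Implicit Types A B : labelled_poset C.

(* The component of [f] at [i], followed by restriction to a subinterval [k] of
   the image of [i]. Labels at intervals that are only propositionally equal are
   thereby compared without casts. *)
Definition along A B (f : lhom A B) (i : intervals (lposet A))
    (k : intervals (lposet B)) (h : hom (interval_functor (lhom_mono f) i) k) :
    hom (lposet_label A i) (lposet_label B k) :=
  fmap (lposet_label B) h ∘ lhom_nat f i.

(** Rewriting by [f = g] directly would change the type of the component at [i]; fixing the target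
    [k] keeps both sides in one hom set. *)
Lemma along_eq A B (f g : lhom A B) i k
    (h : hom (interval_functor (lhom_mono f) i) k)
    (h' : hom (interval_functor (lhom_mono g) i) k) :
  f = g -> along h = along h'.
Proof. by move=> fg; subst g; congr along; apply: bool_irrelevance. Qed.

Lemma along_refl A B (f : lhom A B) i (h : hom (interval_functor (lhom_mono f) i)
    (interval_functor (lhom_mono f) i)) :
  along h = lhom_nat f i.
Proof.
rewrite /along (bool_irrelevance h (lexx _)).
by have /= -> := fmap1 (lposet_label B) (interval_functor (lhom_mono f) i);
   rewrite comp1c.
Qed.

Lemma along_id A i k (h : hom (interval_functor (lhom_mono (lhom_id A)) i) k)
    (h' : hom i k) :
  along h = fmap (lposet_label A) h'.
Proof.
by rewrite /along compc1; congr (fmap (lposet_label A)); apply: bool_irrelevance.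
Qed.

Lemma along_fmap A B (f : lhom A B) i j k (u : hom i j)
    (h : hom (interval_functor (lhom_mono f) j) k)
    (h' : hom (interval_functor (lhom_mono f) i) k) :
  along h ∘ fmap (lposet_label A) u = along h'.
Proof.
rewrite /along -compA (ntnat (lhom_nat f) u) compA /= -fmapM.
by congr (fmap (lposet_label B) _ ∘ _); apply: bool_irrelevance.
Qed.

Lemma fmap_along A B (f : lhom A B) i k l (v : hom k l)
    (h : hom (interval_functor (lhom_mono f) i) k)
    (h' : hom (interval_functor (lhom_mono f) i) l) :
  fmap (lposet_label B) v ∘ along h = along h'.
Proof.
rewrite /along compA -fmapM.
by congr (fmap (lposet_label B) _ ∘ _); apply: bool_irrelevance.
Qed.

(** The intermediate [k] need not be the whole image of [i]: naturality of [g] moves the restriction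
    to [k] past [g], where it merges with the restriction to [l]. *)
Lemma along_comp A B D (g : lhom B D) (f : lhom A B) i k l
    (h : hom (interval_functor (lhom_mono f) i) k)
    (h' : hom (interval_functor (lhom_mono g) k) l)
    (h'' : hom (interval_functor (lhom_mono (lhom_comp g f)) i) l) :
  along h'' = along h' ∘ along h.
Proof.
(* The same inequality [h''], read at the convertible iterated image of [i]. *)
have gh'' : hom (interval_functor (lhom_mono g) (interval_functor (lhom_mono f) i)) l
  := h''.
have -> : along h' ∘ along h = along gh'' ∘ lhom_nat f i.
  by rewrite -(along_fmap h h' gh'') -compA.
by rewrite /along /= /lhom_comp_app compA (bool_irrelevance h'' gh'').
Qed.

(** Once the underlying maps agree, choosing [k] to be the image of [i] makes the restriction an
    identity and recovers the components. *)
Lemma lhom_eq A B (f g : lhom A B) :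
    lhom_map f =1 lhom_map g ->
    (forall i k (h : hom (interval_functor (lhom_mono f) i) k)
      (h' : hom (interval_functor (lhom_mono g) i) k), along h = along h') ->
  f = g.
Proof.
case: f g => [f fm al] [g gm be] /= /funext fg; subst g.
have e := Prop_irrelevance fm gm; subst gm => fg.
congr LHom; apply: nattrans_eq => i.
by have := fg i _ (lexx _) (lexx _); rewrite !along_refl.
Qed.

End Along.

(** * The limit lattice and its labelling *)

Section PosetalLimit.
Variables (C : category) (T : finType) (J : category) (e : T -> J).
Variable D : functor (full_image e) (posetal_diagrams C).

Local Notation lat i := (pdiag_lattice (D i)).
Local Notation label i := (pdiag_label (D i)).

Definition arrow (i j : full_image e) (u : hom i j) :
    lhom (pdiag_labelled (D i)) (pdiag_labelled (D j)) :=
  sval (fmap D u).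

Definition transition (i j : T) (f : lat i -> lat j) : Prop :=
  exists u : hom (i : full_image e) j, f = lhom_map (arrow u).

Lemma transition_hom i j (f : lat i -> lat j) : transition f -> lattice_hom f.
Proof. by move=> [u ->]; apply: (proj2_sig (fmap D u)). Qed.

Definition limit_lattice : finTBDistrLatticeType (Order.Disp tt tt) :=
  compatible_lattice transition_hom.

Definition limit_proj (i : full_image e) (x : limit_lattice) : lat i :=
  family_proj i x.

Lemma limit_proj_mono i : {homo limit_proj i : x y / x <= y}.
Proof. by move=> x y /le_familyP. Qed.

Lemma limit_projM i j (u : hom i j) x :
  lhom_map (arrow u) (limit_proj i x) = limit_proj j x.
Proof. by apply: (family_compatible x); exists u. Qed.

Definition limit_interval (i : full_image e) :
    functor (intervals limit_lattice) (intervals (lat i)) :=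
  interval_functor (@limit_proj_mono i).

(** The two intervals are in fact equal, as the end points of [I] are compatible families, but not
    by conversion; [along] only needs the inequality. *)
Lemma transition_le i j (u : hom i j) (I : intervals limit_lattice) :
  hom (interval_functor (lhom_mono (arrow u)) (limit_interval i I))
      (limit_interval j I).
Proof. by rewrite /= le_pintervalE /= !limit_projM !lexx. Qed.

Definition stage_map (I : intervals limit_lattice) i j (u : hom i j) :
    hom (label i (limit_interval i I)) (label j (limit_interval j I)) :=
  along (transition_le u I).

Lemma stage_map1 I i : stage_map I (idc i) = idc _.
Proof.
have id_le : hom (interval_functor (lhom_mono (lhom_id (pdiag_labelled (D i))))
    (limit_interval i I)) (limit_interval i I) by exact: lexx.
rewrite /stage_map (along_eq _ id_le); last by rewrite /arrow fmap1.
by rewrite (along_id _ (idc _)) fmap1.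
Qed.

Lemma stage_mapM I i j k (v : hom j k) (u : hom i j) :
  stage_map I (v ∘ u) = stage_map I v ∘ stage_map I u.
Proof.
have arrowM : arrow (v ∘ u) = lhom_comp (arrow v) (arrow u).
  by rewrite /arrow fmapM.
have comp_le : hom (interval_functor (lhom_mono (lhom_comp (arrow v) (arrow u)))
    (limit_interval i I)) (limit_interval k I).
  by rewrite /= le_pintervalE /= !limit_projM !lexx.
rewrite /stage_map (along_eq _ comp_le arrowM).
exact: (along_comp (transition_le u I) (transition_le v I) comp_le).
Qed.

(** The diagram of labels [X_i(I_i)] whose limit will be the label of [I]. *)
Definition stage (I : intervals limit_lattice) : functor (full_image e) C :=
  Functor (stage_map1 I) (stage_mapM I).

Lemma stage_trans_natural I K (IK : hom I K) i j (u : hom i j) :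
  fmap (label j) (fmap (limit_interval j) IK) ∘ fmap (stage I) u =
  fmap (stage K) u ∘ fmap (label i) (fmap (limit_interval i) IK).
Proof.
have h : hom (interval_functor (lhom_mono (arrow u)) (limit_interval i I))
    (limit_interval j K) :=
  thin_comp (fmap (limit_interval j) IK) (transition_le u I).
rewrite /= /stage_map; etransitivity; first exact: (fmap_along _ _ h).
symmetry; exact: (along_fmap _ _ h).
Qed.

Definition stage_trans I K (IK : hom I K) : nattrans (stage I) (stage K) :=
  @NatTrans _ _ (stage I) (stage K)
    (fun i => fmap (label i) (fmap (limit_interval i) IK))
    (stage_trans_natural IK).

Hypothesis HC : has_finite_limits C.
Hypothesis He : finite_category (full_image e).

Definition stage_limit I : {l : C & {p : forall i, hom l (stage I i) | is_limit p}}.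
Proof. by have [l /cid[p pP]] := cid (HC He (stage I)); exists l, p. Qed.

Definition limit_label_ob I : C := projT1 (stage_limit I).
Definition limit_label_proj I i : hom (limit_label_ob I) (stage I i) :=
  sval (projT2 (stage_limit I)) i.

Lemma limit_label_projP I : is_limit (limit_label_proj I).
Proof. exact: proj2_sig (projT2 (stage_limit I)). Qed.

Lemma limit_label_map_subproof I K (IK : hom I K) :
  exists m : hom (limit_label_ob I) (limit_label_ob K),
    forall i, limit_label_proj K i ∘ m = stage_trans IK i ∘ limit_label_proj I i.
Proof.
have [|m [mP _]] := proj2 (limit_label_projP K) _
  (fun i => stage_trans IK i ∘ limit_label_proj I i); last by exists m.
move=> i j u; rewrite compA -ntnat -compA.
by rewrite (proj1 (limit_label_projP I)).
Qed.

Definition limit_label_map I K (IK : hom I K) :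
    hom (limit_label_ob I) (limit_label_ob K) :=
  sval (cid (limit_label_map_subproof IK)).

Lemma limit_label_mapP I K (IK : hom I K) i :
  limit_label_proj K i ∘ limit_label_map IK =
  stage_trans IK i ∘ limit_label_proj I i.
Proof. exact: proj2_sig (cid (limit_label_map_subproof IK)) i. Qed.

Lemma limit_label_map1 I : limit_label_map (idc I) = idc _.
Proof.
apply: (limit_joint_monic (limit_label_projP I)) => i.
have trans1 := functor_comp_id (label i) (limit_interval i) I.
by rewrite limit_label_mapP compc1 [stage_trans _ i]trans1 comp1c.
Qed.

Lemma limit_label_mapM I K M (KM : hom K M) (IK : hom I K) :
  limit_label_map (KM ∘ IK) = limit_label_map KM ∘ limit_label_map IK.
Proof.
apply: (limit_joint_monic (limit_label_projP M)) => i.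
rewrite limit_label_mapP compA limit_label_mapP -compA limit_label_mapP compA.
by rewrite -[stage_trans KM i ∘ _](functor_comp_comp (label i) (limit_interval i)).
Qed.

Definition limit_label : functor (intervals limit_lattice) C :=
  Functor limit_label_map1 limit_label_mapM.

Lemma limit_proj_hom i : lattice_hom (limit_proj i).
Proof. exact: family_proj_hom. Qed.

Lemma limit_label_local : local_functor limit_label.
Proof.
move=> a b x f g fg_atomic w p q pb.
apply: (limit_pullback (f := stage_trans f) (g := stage_trans g)
    (p := stage_trans p) (q := stage_trans q)
    (limit_label_projP a) (limit_label_projP b) (limit_label_projP x)
    (limit_label_projP w)); try exact: limit_label_mapP.
(* At each index the projection preserves the atomic cospan and its pullback, and the label there is
   local. *)
move=> i; apply: pdiag_local.
  exact: (interval_functor_atomic (h_mono := @limit_proj_mono i)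
    (limit_proj_hom i) fg_atomic).
exact: (interval_functor_pullback (limit_proj_hom i) (@limit_proj_mono i) pb).
Qed.

(** * The limit cone and its joint monicity *)

Definition limit_diagram : posetal_diagrams C :=
  PosetalDiagram limit_label_local.

Definition limit_cone_label i : nattrans limit_label
    (functor_comp (label i) (limit_interval i)) :=
  @NatTrans _ _ limit_label (functor_comp (label i) (limit_interval i))
    (fun I => limit_label_proj I i) (fun I K IK => limit_label_mapP IK i).

Definition limit_cone_lhom i :
    lhom (pdiag_labelled limit_diagram) (pdiag_labelled (D i)) :=
  @LHom C (pdiag_labelled limit_diagram) (pdiag_labelled (D i))
    _ (@limit_proj_mono i) (limit_cone_label i).

Definition limit_cone i : hom limit_diagram (D i) :=
  exist (@posetal_hom C limit_diagram (D i)) (limit_cone_lhom i)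
    (limit_proj_hom i).

Lemma limit_cone_along i I
    (h : hom (interval_functor (lhom_mono (limit_cone_lhom i)) I)
      (limit_interval i I)) :
  along h = limit_label_proj I i.
Proof. exact: (@along_refl _ _ _ (limit_cone_lhom i) I h). Qed.

Lemma limit_cone_is_cone : is_cone (D := D) limit_cone.
Proof.
move=> i j u; apply: sub_hom_eq; apply: lhom_eq => [x | I k h h'].
  exact: limit_projM.
have refl_le : hom (interval_functor (lhom_mono (limit_cone_lhom i)) I)
    (limit_interval i I) := lexx _.
(* The target [k] is reached by first restricting to the [j]-th projection of [I], where the cone
   equation over [stage I] applies; [v] is the remaining restriction. *)
have v : hom (limit_interval j I) k := h'.
have u_le : hom (interval_functor (lhom_mono (arrow u)) (limit_interval i I)) k
  := thin_comp v (transition_le u I).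
rewrite (along_comp refl_le u_le h) -(fmap_along v (transition_le u I) u_le).
rewrite (limit_cone_along refl_le) -compA.
rewrite [_ ∘ limit_label_proj I i](proj1 (limit_label_projP I) i j u).
by rewrite [v](bool_irrelevance _ h').
Qed.

Lemma limit_cone_joint_monic (W : posetal_diagrams C) (m m' : hom W limit_diagram) :
  (forall i, limit_cone i ∘ m = limit_cone i ∘ m') -> m = m'.
Proof.
move=> mm'; apply: sub_hom_eq; apply: lhom_eq => [y | I k h h'].
  apply: family_eq => i.
  exact: (f_equal (fun f : hom W (D i) => lhom_map (sval f) y) (mm' i)).
apply: (limit_joint_monic (limit_label_projP k)) => i.
have refl_le : hom (interval_functor (lhom_mono (limit_cone_lhom i)) k)
    (limit_interval i k) := lexx _.
(* Reading the projection as a component of [limit_cone i] turns both sides into components of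
   composites, to which [mm'] applies. *)
rewrite -(limit_cone_along refl_le).
have comp_le (n : hom W limit_diagram)
    (nk : hom (interval_functor (lhom_mono (sval n)) I) k) :
    hom (interval_functor (lhom_mono (lhom_comp (limit_cone_lhom i) (sval n))) I)
      (limit_interval i k) := fmap (limit_interval i) nk.
etransitivity; first by symmetry; exact: (along_comp h refl_le (comp_le m h)).
etransitivity; last exact: (along_comp h' refl_le (comp_le m' h')).
exact: (@along_eq C (pdiag_labelled W) (pdiag_labelled (D i)) _ _ _ _ _ _
  (f_equal sval (mm' i))).
Qed.

(** * The mediating morphism *)

Section Mediator.
Variables (W : posetal_diagrams C) (q : forall i, hom W (D i)).
Hypothesis q_cone : is_cone q.

Definition leg i : lhom (pdiag_labelled W) (pdiag_labelled (D i)) := sval (q i).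

Lemma leg_cone i j (u : hom i j) : lhom_comp (arrow u) (leg i) = leg j.
Proof. exact: (f_equal sval (q_cone u)). Qed.

Lemma leg_compatible y : compatible transition (fun i => lhom_map (leg i) y).
Proof. by move=> i j f [u ->]; rewrite -(leg_cone u). Qed.

Definition mediator_map (y : pdiag_lattice W) : limit_lattice :=
  mk_family transition_hom (leg_compatible y).

Lemma mediator_mapE i y : limit_proj i (mediator_map y) = lhom_map (leg i) y.
Proof. exact: family_projE. Qed.

Lemma mediator_mono : {homo mediator_map : x y / x <= y}.
Proof.
move=> x y xy; apply/le_familyP => i.
by rewrite !family_projE; apply: (lhom_mono (leg i)).
Qed.

Lemma mediator_hom : lattice_hom mediator_map.
Proof.
split=> [x y|x y||]; apply: family_eq => i.
all: have [fI fU f0 f1] := limit_proj_hom i; have [qI qU q0 q1] := proj2_sig (q i).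
- by rewrite [RHS]fI [LHS]mediator_mapE [LHS]qI /= -!mediator_mapE.
- by rewrite [RHS]fU [LHS]mediator_mapE [LHS]qU /= -!mediator_mapE.
- by rewrite [RHS]f0 [LHS]mediator_mapE [LHS]q0.
- by rewrite [RHS]f1 [LHS]mediator_mapE [LHS]q1.
Qed.

Definition mediator_interval : functor (intervals (pdiag_lattice W))
    (intervals limit_lattice) :=
  interval_functor mediator_mono.

Lemma leg_le i I : hom (interval_functor (lhom_mono (leg i)) I)
  (limit_interval i (mediator_interval I)).
Proof. by rewrite /= le_pintervalE /= !mediator_mapE !lexx. Qed.

(** Factoring this cone through the limit of the stage defines the label component of the mediator
    at [I]. *)
Lemma leg_stage_cone I :
  is_cone (D := stage (mediator_interval I)) (fun i => along (leg_le i I)).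
Proof.
move=> i j u.
have comp_le : hom (interval_functor (lhom_mono (lhom_comp (arrow u) (leg i))) I)
    (limit_interval j (mediator_interval I)).
  by rewrite leg_cone; exact: leg_le.
etransitivity.
  symmetry; exact: (along_comp (leg_le i I) (transition_le u _) comp_le).
exact: (@along_eq C (pdiag_labelled W) (pdiag_labelled (D j)) _ _ _ _ _ _
  (leg_cone u)).
Qed.

Lemma mediator_label_subproof I :
  exists m : hom (pdiag_label W I) (limit_label (mediator_interval I)),
    forall i, limit_label_proj (mediator_interval I) i ∘ m = along (leg_le i I).
Proof.
have [m [mP _]] := proj2 (limit_label_projP _) _ _ (@leg_stage_cone I).
by exists m.
Qed.

Definition mediator_label_app I := sval (cid (mediator_label_subproof I)).

Lemma mediator_labelP I i :
  limit_label_proj (mediator_interval I) i ∘ mediator_label_app I =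
  along (leg_le i I).
Proof. exact: proj2_sig (cid (mediator_label_subproof I)) i. Qed.

Lemma mediator_label_natural I K (IK : hom I K) :
  mediator_label_app K ∘ fmap (pdiag_label W) IK =
  fmap limit_label (fmap mediator_interval IK) ∘ mediator_label_app I.
Proof.
apply: (limit_joint_monic (limit_label_projP (mediator_interval K))) => i.
(* After projection to [i], both sides become the component of [leg i] at [I] restricted along
   [IK_le]. *)
have IK_le : hom (interval_functor (lhom_mono (leg i)) I)
    (limit_interval i (mediator_interval K)) :=
  thin_comp (leg_le i K) (fmap (interval_functor (lhom_mono (leg i))) IK).
rewrite compA mediator_labelP [RHS]compA limit_label_mapP -[RHS]compA.
rewrite mediator_labelP.
etransitivity; first exact: (along_fmap _ _ IK_le).
symmetry; exact: (fmap_along _ _ IK_le).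
Qed.

Definition mediator_lhom : lhom (pdiag_labelled W) (pdiag_labelled limit_diagram) :=
  @LHom C (pdiag_labelled W) (pdiag_labelled limit_diagram) _ mediator_mono
    (@NatTrans _ _ (pdiag_label W) (functor_comp limit_label mediator_interval)
      mediator_label_app mediator_label_natural).

Definition mediator : hom W limit_diagram :=
  exist (@posetal_hom C W limit_diagram) mediator_lhom mediator_hom.

Lemma mediatorP i : limit_cone i ∘ mediator = q i.
Proof.
apply: sub_hom_eq; apply: lhom_eq => [y | I k h h'].
  exact: mediator_mapE.
(* The component of the composite at [I] unfolds to the projection after [mediator_label_app], so
   the factorization defining the latter reduces the goal to [leg i]. *)
have v : hom (limit_interval i (mediator_interval I)) k := h.
transitivity (fmap (label i) v ∘ (limit_label_proj (mediator_interval I) i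
    ∘ mediator_label_app I)).
  by rewrite [v](bool_irrelevance _ h).
rewrite [limit_label_proj _ i ∘ _]mediator_labelP.
exact: (@fmap_along _ _ _ (leg i)).
Qed.

End Mediator.

(** * Universality and transport to an arbitrary finite shape *)

Lemma limit_cone_limit : is_limit (D := D) limit_cone.
Proof.
split=> [|W q q_cone]; first exact: limit_cone_is_cone.
exists (mediator q_cone); split=> [i | m mP]; first exact: mediatorP.
by apply: limit_cone_joint_monic => i; rewrite mediatorP mP.
Qed.

End PosetalLimit.

Theorem corollary4p12 (C : category) :
  has_finite_limits C -> has_finite_limits (posetal_diagrams C).
Proof.
move=> HC J Jfin D; have [[n [e e_surj]] _] := Jfin.
have Efin := full_image_finite e Jfin.
(* The limit is built over the enumeration by ['I_n]; its apex also serves for the original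
   shape. *)
exists (limit_diagram (full_image_restrict e D) HC Efin).
exact: limit_of_full_image e_surj (limit_cone_limit _ HC Efin).
Qed.
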